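(* Let $n\ge1$, let $\Phi$ be the root system of type $A_n$, and let $\ell,m$ be integers with $|\ell|\le m$ and $m+1\ge n\ell$. Then the minimum periods of the characteristic quasi-polynomials of $\mathcal{A}_n^{[\ell,m]}$ and of $\mathrm{cIsh}_n$ are $$\rho_{\mathcal{A}_n^{[\ell,m]}}=\operatorname{lcm}\{1,2,\dots,mn-\ell\},\qquad \rho_{\mathrm{cIsh}_n}=\operatorname{lcm}\{1,2,\dots,n\}.$$ In particular $\mathcal{A}_n^{[0,1]}$ and $\mathrm{cIsh}_n$ have the same minimum period.
   Context: Let $\epsilon_1,\dots,\epsilon_{n+1}$ be the standard basis of $\mathbb{R}^{n+1}$; simple roots $\alpha_i=\epsilon_i-\epsilon_{i+1}$, positive roots $\alpha_{i,j}=\epsilon_i-\epsilon_j=\sum_{k=i}^{j-1}\alpha_k$ ($1\le i<j\le n+1$), each identified with its coefficient vector in $\mathbb{Z}^n$ with respect to the simple roots. The $[\ell,m]$-deformation $\mathcal{A}_n^{[\ell,m]}$ is the integer matrix with $n+1$ rows whose columns are $\binom{\beta}{-x}$ for every positive root $\beta$ and every integer $x$ with $\ell\le x\le m$, together with $(0,\dots,0,1)^T$. The matrix $\mathrm{cIsh}_n$ has $n+1$ rows and columns: $\binom{\beta}{0}$ for every positive root $\beta$; $\binom{\alpha_{1,j}}{-x}$ for every $2\le j\le n+1$ and every integer $1\le x\le j-1$; and $(0,\dots,0,1)^T$. For an integer matrix $\mathcal{C}$ with $N$ rows and nonzero primitive columns $c_1,\dots,c_p$ and a positive integer $q$, let $M_q(\mathcal{C})=\#\{z\in(\mathbb{Z}/q\mathbb{Z})^N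 : z\,c_j\not\equiv 0 \pmod q\text{ for all }j\}$ (with $z$ a row vector). It is known that there is a quasi-polynomial $\chi^{\mathrm{quasi}}_{\mathcal{C}}$ (a function $\mathbb{Z}\to\mathbb{C}$ given, for some period $\rho>0$, by polynomials $f^k$ with $\chi(q)=f^k(q)$ whenever $q\equiv k\pmod\rho$) agreeing with $M_q(\mathcal{C})$ for all sufficiently large $q$; this is the characteristic quasi-polynomial, and $\rho_{\mathcal{C}}$ denotes its minimum period (smallest such $\rho$). The lcm of the empty set is $1$. *)

(* Defs.v *)
From mathcomp Require Import all_boot all_order all_algebra.
From mathcomp Require Import boolp classical_sets reals complex.

Set Implicit Arguments.
Unset Strict Implicit.
Unset Printing Implicit Defensive.

Import Order.TTheory GRing.Theory Num.Theory.
Local Open Scope ring_scope.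
Local Open Scope complex_scope.

Section RootsOfTypeA.
Variable n : nat.

(* Indices are 1-based: row [r : 'I_n] is the coordinate along alpha_(r+1). *)
Definition simple_root (k : nat) : 'cV[int]_n := \col_r (r.+1 == k)%:R.

Definition pos_root (i j : nat) : 'cV[int]_n :=
  \sum_(i <= k < j) simple_root k.

Definition pos_roots : seq 'cV[int]_n :=
  [seq pos_root i j | i <- index_iota 1 n.+2, j <- index_iota i.+1 n.+2].

Definition cone_col (b : 'cV[int]_n) (x : int) : 'cV[int]_(n + 1) :=
  col_mx b (const_mx (- x)).

Definition infinity_col : 'cV[int]_(n + 1) := col_mx 0 (const_mx 1).

End RootsOfTypeA.

Definition zrange (l m : int) : seq int :=
  if l <= m then [seq l + k%:Z | k <- iota 0 `|m - l|%N.+1] else [::].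

Definition mx_of_cols (N : nat) (s : seq 'cV[int]_N) : 'M[int]_(N, size s) :=
  \matrix_(i, j) (nth 0 s j) i 0.

Definition deformation_cols (n : nat) (l m : int) : seq 'cV[int]_(n + 1) :=
  rcons [seq cone_col b x | b <- pos_roots n, x <- zrange l m]
        (infinity_col n).

Definition deformation (n : nat) (l m : int) :=
  mx_of_cols (deformation_cols n l m).

Definition cIsh_cols (n : nat) : seq 'cV[int]_(n + 1) :=
  [seq cone_col b 0 | b <- pos_roots n]
  ++ [seq cone_col (pos_root n 1 j) x%:Z
        | j <- index_iota 2 n.+2, x <- index_iota 1 j]
  ++ [:: infinity_col n].

Definition cIsh (n : nat) := mx_of_cols (cIsh_cols n).

(* Z/qZ is represented by the residues 'I_q rather than by 'Z_q, which is not
   Z/qZ for q = 1. *)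
Definition char_count (N p : nat) (C : 'M[int]_(N, p)) (q : nat) : nat :=
  #|[set z : 'rV['I_q]_N |
      [forall j, ~~ (q%:Z %| \sum_i (z 0 i)%:Z * C i j)%Z]]|.

Section QuasiPolynomials.
Variable R : realType.

Definition quasi_period (chi : int -> R[i]) (rho : nat) : Prop :=
  (0 < rho)%N /\
  exists f : 'I_rho -> {poly R[i]},
    forall (q : int) (k : 'I_rho),
      (q = k%:Z %[mod rho%:Z])%Z -> chi q = (f k).[q%:~R].

Definition quasi_polynomial (chi : int -> R[i]) : Prop :=
  exists rho, quasi_period chi rho.

Definition is_min_period (chi : int -> R[i]) (rho : nat) : Prop :=
  quasi_period chi rho /\
  forall rho', quasi_period chi rho' -> (rho <= rho')%N.

Definition is_char_quasi_poly (N p : nat) (C : 'M[int]_(N, p))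
    (chi : int -> R[i]) : Prop :=
  quasi_polynomial chi /\
  exists q0 : nat, forall q : nat, (q0 <= q)%N ->
    chi q%:Z = (char_count C q)%:R.

Lemma poly_eq_large (f g : {poly R[i]}) (a : int) (d : nat) :
  (0 < d)%N ->
  (exists t0 : nat, forall t : nat, (t0 <= t)%N ->
     f.[(a + (t * d)%:Z)%:~R] = g.[(a + (t * d)%:Z)%:~R]) ->
  f = g.
Proof.
move=> d0 [t0 fg]; apply/eqP; rewrite -subr_eq0; apply/eqP.
set h := f - g; pose pt (t : nat) : R[i] := (a + ((t0 + t) * d)%:Z)%:~R.
apply: (@roots_geq_poly_eq0 _ _ [seq pt t | t <- iota 0 (size h)]).
- apply/allP => _ /mapP[t _ ->].
  by rewrite /root /h hornerD hornerN fg ?subrr // leq_addr.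
- rewrite map_inj_uniq ?iota_uniq // => s t /intr_inj /addrI [].
  by move/eqP; rewrite eqn_pmul2r // eqn_add2l => /eqP.
- by rewrite size_map size_iota.
Qed.

Lemma is_char_quasi_poly_unique (N p : nat) (C : 'M[int]_(N, p))
    (chi chi' : int -> R[i]) :
  is_char_quasi_poly C chi -> is_char_quasi_poly C chi' -> chi = chi'.
Proof.
move=> [[r [r0 [f fE]]] [q0 cE]] [[r' [r'0 [f' f'E]]] [q0' c'E]].
apply/funext => q.
have res (s : nat) : (0 < s)%N ->
    exists k : 'I_s, forall t : nat, (q + (t * s)%:Z = k%:Z %[mod s%:Z])%Z.
  move=> s0; have sz : s%:Z != 0 by rewrite eqz_nat -lt0n.
  have klt : (`|(q %% s%:Z)%Z| < s)%N.
    by rewrite -ltz_nat gez0_abs ?modz_ge0 // ltz_pmod.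
  exists (Ordinal klt) => t /=.
  by rewrite gez0_abs ?modz_ge0 // modz_mod PoszM addrC modzMDl.
have [k kE] := res _ r0; have [k' k'E] := res _ r'0.
have big (t : nat) : chi (q + (t * (r * r'))%:Z) = (f k).[(q + (t * (r * r'))%:Z)%:~R].
  by apply: fE; rewrite (mulnC r) mulnA kE.
have big' (t : nat) : chi' (q + (t * (r * r'))%:Z) = (f' k').[(q + (t * (r * r'))%:Z)%:~R].
  by apply: f'E; rewrite mulnA k'E.
have rr0 : (0 < r * r')%N by rewrite muln_gt0 r0.
suff ff' : f k = f' k'.
  by have := big 0%N; have := big' 0%N; rewrite mul0n addr0 ff' => -> ->.
apply: (@poly_eq_large _ _ q (r * r')) => //.
exists (q0 + q0' + `|q|)%N => t tge; rewrite -big -big'.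
have tle : (t <= t * (r * r'))%N by rewrite leq_pmulr.
have : (q0 + q0')%:Z <= q + (t * (r * r'))%:Z.
  have := leq_trans tge tle; rewrite -lez_nat PoszD => h.
  rewrite -lerBlDl; apply: le_trans h; rewrite lerD2l abszE.
  by rewrite -normrN ler_norm.
case: (q + _) => [u|//]; rewrite lez_nat => uge.
rewrite cE ?c'E //; first exact: leq_trans (leq_addl _ _) uge.
exact: leq_trans (leq_addr _ _) uge.
Qed.

(* The value is 0, which is never a period, unless C has a characteristic
   quasi-polynomial. *)
Definition min_period (N p : nat) (C : 'M[int]_(N, p)) : nat :=
  xget 0%N (fun rho =>
    exists2 chi, is_char_quasi_poly C chi & is_min_period chi rho).

Lemma min_periodE (N p : nat) (C : 'M[int]_(N, p)) (chi : int -> R[i])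
    (rho : nat) :
  is_char_quasi_poly C chi -> is_min_period chi rho -> min_period C = rho.
Proof.
move=> Cchi [per minr]; apply: xget_unique => [|r]; first by exists chi.
move=> [chi' /(is_char_quasi_poly_unique Cchi) <- [per' minr']].
by apply/eqP; rewrite eqn_leq minr // minr'.
Qed.

End QuasiPolynomials.

Definition lcm_upto (N : nat) : nat := \big[lcmn/1%N]_(1 <= k < N.+1) k.

(* Main.v *)
Require Import Defs.
From mathcomp Require Import all_boot all_order all_algebra.
From mathcomp Require Import all_fingroup all_solvable.
From mathcomp Require Import boolp reals complex zify.

(** In the coordinates [x_k = y_k - y_(k+1)], and with [t] the last coordinate,
    [M_q] counts the [t <> 0] and the colorings [y] of the vertices
    [1, ..., n+1] by [Z/q], up to translation, such that [y_i - y_j <> c t] for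
    every edge [(i, j, c)] of an integral gain graph.  For fixed [t] this number
    only depends on the order [r] of [t], and deletion-contraction makes it a
    polynomial [p_r(q)]; cycles enter only through whether [r] divides their
    gain.  When [r] exceeds the largest gain [B] of a cycle, [p_r] is the
    polynomial [p_0] of the graph with integral gains, hence
    [M_q = (q - 1) p_0(q) + sum_(2 <= r <= B, r | q) phi(r) (p_r - p_0)(q)]
    and [lcm(1, ..., B)] is a period.

    Deletion-contraction also shows that [(-1)^n p_r(-1)] is a natural number,
    at most [(-1)^n p_0(-1)], and strictly smaller as soon as some cycle has
    gain [r].  Both graphs have a cycle of gain [r] for each [1 <= r <= B];
    this is where [n l <= m + 1] is needed.  So all the [(p_r - p_0)(-1)] have
    the same strict sign, and comparing at [-1] the constituents of residues
    [0] and [rho] of a period [rho] shows that every [r <= B] divides [rho]. *)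

Set Implicit Arguments.
Unset Strict Implicit.
Unset Printing Implicit Defensive.

Import Order.TTheory GRing.Theory Num.Theory.
Local Open Scope ring_scope.

(** * Deletion-contraction for gain graphs *)

Section GainGraphs.
Variable I : finType.

(* [(i, j, c)] stands for the equation [y_i - y_j = c t]. *)
Definition edge : Type := (I * I * int)%type.
(* After contractions, the color of [k] is [y (s k).1 + (s k).2 t]. *)
Definition switching : Type := I -> I * int.
Implicit Types (r : nat) (e : edge) (A : seq edge) (s : switching) (V : {set I}).

(** The multiple of [t] left in the equation of [e] once both colors are expressed by
    representatives. *)
Definition gain s e : int := e.2 - (s e.1.1).2 + (s e.1.2).2.

Definition is_loop s e : bool := (s e.1.1).1 == (s e.1.2).1.

Definition contract s e : switching := fun k =>
  if (s k).1 == (s e.1.1).1 then ((s e.1.2).1, (s k).2 + gain s e) else s k.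

Definition no_switching : switching := fun k => (k, 0).

(* [V] holds the representatives of the classes merged so far.  A loop of gain
   [g] is the equation [0 = g t], with [r] the order of [t]; [r = 0] gives the
   integral gain graph.  The exponent [#|V|.-1] rather than [#|V|] accounts for
   colorings being counted up to translation. *)
Fixpoint gain_poly_rec (r : nat) V s A : {poly int} :=
  if A is e :: A' then
    if is_loop s e then
      if (r %| gain s e)%Z then 0 else gain_poly_rec r V s A'
    else gain_poly_rec r V s A'
         - gain_poly_rec r (V :\ (s e.1.1).1) (contract s e) A'
  else 'X^(#|V|.-1).

(** The sum of the absolute values of the coefficients of [gain_poly_rec], which alternate in sign
    as long as [V] contains the representatives. *)
Fixpoint whitney_rec (r : nat) s A : nat :=
  if A is e :: A' then
    if is_loop s e then
      if (r %| gain s e)%Z then 0%N else whitney_rec r s A'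
    else (whitney_rec r s A' + whitney_rec r (contract s e) A')%N
  else 1%N.

Definition gain_poly r A := gain_poly_rec r setT no_switching A.
Definition whitney r A := whitney_rec r no_switching A.

Lemma contract_root s e k :
  ~~ is_loop s e -> (contract s e k).1 != (s e.1.1).1.
Proof.
by rewrite /is_loop /contract => ne; case: ifPn => //= _; rewrite eq_sym.
Qed.

Lemma contract_rootD1 V s e : ~~ is_loop s e -> (forall k, (s k).1 \in V) ->
  forall k, (contract s e k).1 \in V :\ (s e.1.1).1.
Proof.
move=> ne sV k; rewrite in_setD1 contract_root //=.
by rewrite /contract; case: ifP => _; apply: sV.
Qed.

(** A contraction removes one representative from [V], and the resulting sign cancels the minus sign
    of the recursion. *)
Lemma horner_gain_poly_recN1 r V s A :
  (forall k, (s k).1 \in V) ->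
  (gain_poly_rec r V s A).[-1] = (-1) ^+ #|V|.-1 * (whitney_rec r s A)%:Z.
Proof.
elim: A V s => [|e A IH] V s sV /=; first by rewrite hornerXn mulr1.
case: ifPn => [_|ne].
  by case: ifP => _; [rewrite horner0 mulr0 | rewrite IH].
have sV' := contract_rootD1 ne sV.
rewrite hornerD hornerN !IH // PoszD mulrDr; congr (_ + _).
have := cardsD1 (s e.1.1).1 V; rewrite sV => ->.
have -> : #|V :\ (s e.1.1).1| = #|V :\ (s e.1.1).1|.-1.+1.
  by rewrite prednK // card_gt0; apply/set0Pn; exists (contract s e e.1.1).1.
by rewrite /= exprS mulN1r mulNr.
Qed.

Lemma horner_gain_polyN1 r A :
  (gain_poly r A).[-1] = (-1) ^+ #|I|.-1 * (whitney r A)%:Z.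
Proof. by rewrite /gain_poly horner_gain_poly_recN1 ?cardsT // => k; rewrite inE. Qed.

(** For [r = 0] only loops of gain 0 give zero, and these give zero for every [r]. *)
Lemma whitney_rec_le r s A : (whitney_rec r s A <= whitney_rec 0 s A)%N.
Proof.
elim: A s => //= e A IH s; case: ifP => _; last exact: leq_add.
case: ifPn => // nr; rewrite ifF //; apply: contraNF nr.
by rewrite dvd0z => /eqP ->; rewrite dvdz0.
Qed.

Lemma whitney_rec_lt_delete r s e A : ~~ is_loop s e ->
  (whitney_rec r s A < whitney_rec 0 s A)%N ->
  (whitney_rec r s (e :: A) < whitney_rec 0 s (e :: A))%N.
Proof.
by move=> /negbTE /= -> lt; rewrite -addSn leq_add // whitney_rec_le.
Qed.

Lemma whitney_rec_lt_contract r s e A : ~~ is_loop s e ->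
  (whitney_rec r (contract s e) A < whitney_rec 0 (contract s e) A)%N ->
  (whitney_rec r s (e :: A) < whitney_rec 0 s (e :: A))%N.
Proof.
by move=> /negbTE /= -> lt; rewrite -addnS leq_add // whitney_rec_le.
Qed.

Lemma whitney_rec_lt_loop r s e : is_loop s e ->
  (r %| gain s e)%Z -> gain s e != 0 ->
  (whitney_rec r s [:: e] < whitney_rec 0 s [:: e])%N.
Proof. by move=> /= -> -> nz; rewrite dvd0z (negbTE nz). Qed.

(** Follow the branch that deletes all of [A]: it keeps [no_switching], for which edges with
    distinct ends are not loops. *)
Lemma whitney_lt_cat r A A' : (forall e, e \in A -> e.1.1 != e.1.2) ->
  (whitney r A' < whitney 0 A')%N -> (whitney r (A ++ A') < whitney 0 (A ++ A'))%N.
Proof.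
move=> + lt; elim: A => // e A IH loopless.
apply: whitney_rec_lt_delete; first exact/loopless/mem_head.
by apply: IH => f fA; apply: loopless; rewrite inE fA orbT.
Qed.

(** The invariant [inv] bounds the gains of all loops met in the recursion, and [r] divides a
    smaller gain only if that gain is 0. *)
Lemma gain_poly_rec_integral r (inv : switching -> Prop) A V s :
  (forall s e, inv s -> e \in A -> ~~ is_loop s e -> inv (contract s e)) ->
  (forall s e, inv s -> e \in A -> is_loop s e -> `|gain s e| < r%:Z) ->
  inv s -> gain_poly_rec r V s A = gain_poly_rec 0 V s A.
Proof.
elim: A V s => //= e A IH V s inv_contract inv_loop invs.
have IHA V' s' : inv s' -> gain_poly_rec r V' s' A = gain_poly_rec 0 V' s' A.
  move=> ?; apply: IH => // s'' f invs'' fA; [apply: inv_contract | apply: inv_loop] => //;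
    by rewrite inE fA orbT.
case: ifPn => [le|nle].
  have small := inv_loop _ _ invs (mem_head _ _) le.
  rewrite IHA // dvd0z; congr (if _ then _ else _).
  apply/idP/eqP => [|->]; last by rewrite dvdz0.
  move: small; rewrite dvdzE -abszE ltz_nat /= => small dv; apply/eqP.
  rewrite -absz_eq0; case: posnP => // pos; have := dvdn_leq pos dv; lia.
by rewrite !IHA //; apply: inv_contract => //; apply: mem_head.
Qed.

End GainGraphs.

(** * Colorings by a finite abelian group *)

Section Colorings.
Variables (I : finType) (G : finZmodType).
Implicit Types (r : nat) (e : edge I) (A : seq (edge I)) (s : switching I) (V : {set I}).
Implicit Types (y : {ffun I -> G}) (a b : I) (t g d : G).

Definition shift_coord a d y : {ffun I -> G} :=
  [ffun k => if k == a then y k + d else y k].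

Lemma shift_coordK a d : cancel (shift_coord a d) (shift_coord a (- d)).
Proof.
by move=> y; apply/ffunP => k; rewrite !ffunE; case: eqP => // _; rewrite addrK.
Qed.

Lemma shift_coord_bij a d : bijective (shift_coord a d).
Proof.
exists (shift_coord a (- d)); first exact: shift_coordK.
by move=> y; have := shift_coordK a (- d) y; rewrite opprK.
Qed.

(** [Q] ignores coordinate [a], so shifting it identifies the fibres of [y a - y b]. *)
Lemma card_free_coord (Q : pred {ffun I -> G}) a b g : a != b ->
  (forall d y, Q (shift_coord a d y) = Q y) ->
  #|[set y | Q y]| = (#|G| * #|[set y | Q y && (y a - y b == g)%R]|)%N.
Proof.
move=> ab Qa; rewrite -sum1_card.
rewrite (partition_big (fun y => y a - y b) predT) //= -sum_nat_const.
apply: eq_bigr => d _; rewrite -sum1_card.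
rewrite (reindex (shift_coord a (d - g))) /=; last exact/onW_bij/shift_coord_bij.
apply: eq_bigl => y; rewrite !inE Qa !ffunE eqxx [b == a]eq_sym (negbTE ab).
congr (_ && _); rewrite addrAC -subr_eq0 -[in RHS]subr_eq0; congr (_ == _).
by rewrite addrA addrAC addrK.
Qed.

Definition switched_value t s y k : G := y (s k).1 + t *~ (s k).2.

Definition proper_coloring t s A y : bool :=
  all (fun e => switched_value t s y e.1.1 - switched_value t s y e.1.2
                != t *~ e.2) A.

Lemma switched_edge t s e y :
  (switched_value t s y e.1.1 - switched_value t s y e.1.2 == t *~ e.2)
  = (y (s e.1.1).1 - y (s e.1.2).1 == t *~ gain s e).
Proof.
rewrite /switched_value /gain mulrzDr mulrzBr -[LHS]subr_eq0 -[RHS]subr_eq0.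
congr (_ == _); rewrite !opprD !opprK -!addrA; congr (_ + _).
by rewrite addrCA; congr (_ + _); rewrite [RHS]addrCA; congr (_ + _); rewrite addrC.
Qed.

Lemma switched_loop t s e y : is_loop s e ->
  (switched_value t s y e.1.1 - switched_value t s y e.1.2 == t *~ e.2)
  = (t *~ gain s e == 0).
Proof. by rewrite switched_edge eq_sym => /eqP ->; rewrite subrr. Qed.

Lemma proper_coloring_contract t s e A y :
  y (s e.1.1).1 - y (s e.1.2).1 = t *~ gain s e ->
  proper_coloring t (contract s e) A y = proper_coloring t s A y.
Proof.
move=> ye; have ev k : switched_value t (contract s e) y k = switched_value t s y k.
  rewrite /switched_value /contract; case: ifP => //= /eqP ->.
  by rewrite mulrzDr -ye addrCA subrKC addrC.
by apply: eq_all => f; rewrite /= !ev.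
Qed.

Lemma proper_coloring_shift t s e A d y : ~~ is_loop s e ->
  proper_coloring t (contract s e) A (shift_coord (s e.1.1).1 d y)
  = proper_coloring t (contract s e) A y.
Proof.
move=> nl; apply: eq_all => f.
by rewrite /= /switched_value !ffunE !(negbTE (contract_root _ nl)).
Qed.

(** Coordinates outside [V] are free, and one more factor [#|G|] counts translations. For a non-loop
    [e], colorings violating [e] are those of the contraction with one free coordinate fixed. *)
Lemma proper_coloring_card_rec (i0 : I) r t V s A :
  (forall c : int, (t *~ c == 0) = (r %| c)%Z) ->
  (forall k, (s k).1 \in V) ->
  #|[set y | proper_coloring t s A y]|%:Z =
  #|G|%:Z ^+ #|~: V| * #|G|%:Z * (gain_poly_rec r V s A).[#|G|%:Z].
Proof.
move=> tr; elim: A V s => [|e A IH] V s sV /=.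
  rewrite hornerXn -mulrA -exprS prednK; last first.
    by rewrite card_gt0; apply/set0Pn; exists (s i0).1.
  rewrite -exprD addnC cardsC -[#|G|%:Z]natz -natrX natz -card_ffun -cardsT.
  by congr Posz; apply: eq_card => y; rewrite !inE.
case: ifPn => [le|nle].
  case: ifPn => [rg|nrg]; last first.
    rewrite -IH //; congr Posz; apply: eq_card => y; rewrite !inE.
    by rewrite switched_loop // tr nrg.
  rewrite horner0 mulr0; apply/eqP; rewrite eqz_nat cards_eq0; apply/eqP/setP => y.
  by rewrite !inE switched_loop // tr rg.
set a := (s e.1.1).1; set b := (s e.1.2).1.
have ab : a != b by [].
have sV' := contract_rootD1 nle sV.
have := IH _ _ sV'.
rewrite (card_free_coord (t *~ gain s e) ab); last first.
  by move=> d y; rewrite proper_coloring_shift.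
have -> : #|~: (V :\ a)| = #|~: V|.+1.
  have := cardsC V; have := cardsC (V :\ a); have := cardsD1 a V; rewrite sV; lia.
rewrite hornerD hornerN mulrBr -IH // exprS PoszM.
set N := #|[set y | proper_coloring t (contract s e) A y && _]|.
have q0 : #|G|%:Z != 0 by rewrite eqz_nat -lt0n; apply/card_gt0P; exists 0.
rewrite -!mulrA => /(mulfI q0) <-.
have -> : N = #|[set y | proper_coloring t s A y && (y a - y b == t *~ gain s e)]|.
  apply: eq_card => y; rewrite !inE andbC [RHS]andbC.
  by case: eqP => //= ye; rewrite proper_coloring_contract.
apply/eqP; rewrite -subr_eq opprK addrC; apply/eqP; rewrite -PoszD; congr Posz.
rewrite -(cardsID [set y : {ffun I -> G} | y a - y b == t *~ gain s e]
   [set y | proper_coloring t s A y]).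
congr (_ + _)%N; apply: eq_card => y; rewrite !inE //.
by rewrite switched_edge andbC.
Qed.

Lemma proper_coloring_card (i0 : I) r t A :
  (forall c : int, (t *~ c == 0) = (r %| c)%Z) ->
  #|[set y : {ffun I -> G} | all (fun e => y e.1.1 - y e.1.2 != t *~ e.2) A]|%:Z =
  #|G|%:Z * (gain_poly r A).[#|G|%:Z].
Proof.
move=> tr; have := proper_coloring_card_rec (s := @no_switching I) i0 A tr (fun k => in_setT k).
rewrite setCT cards0 expr0 mul1r => <-; congr Posz.
apply: eq_card => y; rewrite !inE; apply: eq_all => e.
by rewrite /= /switched_value /= !addr0.
Qed.

End Colorings.

(** * Columns as edges *)

Section EdgeColumns.
Variable n : nat.
Implicit Types (e : edge 'I_n.+1) (A : seq (edge 'I_n.+1)).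

Definition edge_col e : 'cV[int]_(n + 1) :=
  cone_col (pos_root n e.1.1.+1 e.1.2.+1) e.2.

Lemma pos_rootE (i j : nat) (k : 'I_n) :
  pos_root n i.+1 j.+1 k 0 = ((i <= k < j)%N : nat)%:R.
Proof.
rewrite /pos_root summxE; under eq_bigr do rewrite mxE.
case: (boolP (i <= k < j)%N) => ikj.
  rewrite (bigD1_seq k.+1) ?iota_uniq ?mem_index_iota //= eqxx big1 ?addr0 // => h /negPf.
  by rewrite eq_sym => ->.
rewrite big_nat_cond big1 // => h; case: eqP => // <-.
by rewrite andbT !ltnS (negbTE ikj).
Qed.

Lemma dvdz_sum_Zp q N (z : 'rV['I_q.+2]_N) (c : 'cV[int]_N) :
  (q.+2%:Z %| \sum_i (z 0%R i)%:Z * c i 0)%Z = (\sum_i z 0 i *~ c i 0 == 0).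
Proof.
have cast (a : int) : (q.+2%:Z %| a)%Z = ((a%:~R : 'I_q.+2) == 0).
  have nat_cast (k : nat) : (q.+2 %| k)%N = ((k%:R : 'I_q.+2) == 0).
    by rewrite -[RHS]val_eqE /= Zp_nat /= /dvdn.
  case: a => k; first by rewrite -nat_cast.
  by rewrite NegzE rmorphN oppr_eq0 -nat_cast.
rewrite cast rmorph_sum /=; congr (_ == _); apply: eq_bigr => i _.
by rewrite rmorphM /= mulrzr; congr (_ *~ _); apply: natr_Zp.
Qed.

Definition difference_row (G : finZmodType) (y : {ffun 'I_n.+1 -> G}) (t : G) :
    'rV[G]_(n + 1) :=
  row_mx (\row_(k < n) (y (inord k) - y (inord k.+1))) (const_mx t).

Lemma difference_row_edge (G : finZmodType) (y : {ffun 'I_n.+1 -> G}) (t : G) e :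
  (e.1.1 < e.1.2)%N ->
  \sum_i difference_row y t 0 i *~ edge_col e i 0 = y e.1.1 - y e.1.2 - t *~ e.2.
Proof.
case: e => [[i j] c] /= ij; rewrite big_split_ord /= big_ord1.
congr (_ + _); last by rewrite row_mxEr col_mxEd !mxE mulrNz.
transitivity (\sum_(k < n | (i <= k < j)%N) (y (inord k) - y (inord k.+1))).
  rewrite [RHS]big_mkcond; apply: eq_bigr => k _.
  by rewrite row_mxEl col_mxEu pos_rootE mxE; case: ifP; rewrite ?mulr0z.
have jn : (j <= n)%N by rewrite -ltnS.
rewrite -(big_mkord (fun k => i <= k < j)%N (fun k => y (inord k) - y (inord k.+1))).
transitivity (\sum_(i <= k < j) (y (inord k) - y (inord k.+1))).
  rewrite (big_nat_widen _ _ _ _ _ jn) (big_nat_widenl _ _ _ _ _ (leq0n i)) /=.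
  by apply: eq_bigl => k; rewrite andbC.
rewrite -[LHS]opprK -sumrN (eq_bigr (fun k => y (inord k.+1) - y (inord k))); last first.
  by move=> k _; rewrite opprB.
by rewrite (telescope_sumr (fun k => y (inord k)) (ltnW ij)) !inord_val opprB.
Qed.

Lemma difference_row_infinity (G : finZmodType) (y : {ffun 'I_n.+1 -> G}) (t : G) :
  \sum_i difference_row y t 0 i *~ infinity_col n i 0 = t.
Proof.
rewrite big_split_ord /= big_ord1 big1 ?add0r => [|k _]; last first.
  by rewrite col_mxEu [X in _ *~ X]mxE mulr0z.
by rewrite row_mxEr col_mxEd !mxE.
Qed.

(** Differences determine a coloring up to translation, and the color of the first vertex fixes the
    translation. *)
Lemma difference_row_bij (G : finZmodType) :
  bijective (fun p : {ffun 'I_n.+1 -> G} * G => (difference_row p.1 p.2, p.1 ord0)).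
Proof.
apply: inj_card_bij => [[y t] [y' t']|]; last first.
  by rewrite !card_prod card_ffun card_mx !card_ord mul1n addn1.
case=> /eq_row_mx[/rowP dy /rowP tt'] y0.
congr (_, _); last by have := tt' 0; rewrite !mxE.
apply/ffunP => k; rewrite -(inord_val k).
case: k => k /=; elim: k => [|k IH] kn.
  by have -> : inord 0 = ord0 :> 'I_n.+1 by apply: val_inj; rewrite /= inordK.
have := dy (Ordinal (kn : (k < n)%N)); rewrite !mxE /= (IH (ltnW kn)).
by move/addrI/oppr_inj.
Qed.

(** The factor [q.+2] on the left counts translations. The column at infinity forces [t != 0]. *)
Lemma char_count_edges (cols : seq 'cV[int]_(n + 1)) A q :
  cols =i infinity_col n :: map edge_col A ->
  (forall e, e \in A -> (e.1.1 < e.1.2)%N) ->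
  (q.+2 * char_count (mx_of_cols cols) q.+2 =
   \sum_(t : 'I_q.+2 | t != 0%R)
    #|[set y : {ffun 'I_n.+1 -> 'I_q.+2} |
        all (fun e => y e.1.1 - y e.1.2 != t *~ e.2)%R A]|)%N.
Proof.
move=> colsE Alt.
pose ok (z : 'rV['I_q.+2]_(n + 1)) := all (fun c : 'cV[int]_(n + 1) => \sum_i z 0 i *~ c i 0 != 0) cols.
have -> : char_count (mx_of_cols cols) q.+2 = #|[set z | ok z]|.
  apply: eq_card => z; rewrite !inE; apply/forallP/allP => [h c ccols|h j].
    have := h (Ordinal (etrans (index_mem c cols) ccols)).
    rewrite -dvdz_sum_Zp; under eq_bigr do rewrite mxE /= nth_index //.
    by [].
  under eq_bigr do rewrite mxE.
  by rewrite dvdz_sum_Zp h // mem_nth.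
transitivity (\sum_(p : 'rV['I_q.+2]_(n + 1) * 'I_q.+2 | ok p.1) 1)%N.
  transitivity (\sum_(z | ok z) \sum_(g : 'I_q.+2) 1)%N.
    under eq_bigr do rewrite sum1_card card_ord.
    by rewrite sum_nat_const mulnC cardsE.
  by rewrite pair_big_dep; apply: eq_bigl => p; rewrite andbT.
rewrite (reindex _ (onW_bij _ (difference_row_bij _))) /=.
pose P (t : 'I_q.+2) (y : {ffun 'I_n.+1 -> 'I_q.+2}) :=
   all (fun e => y e.1.1 - y e.1.2 != t *~ e.2) A.
have okE y t : ok (difference_row y t) = (t != 0) && P t y.
  rewrite /ok (eq_all_r colsE) /= difference_row_infinity; congr (_ && _).
  rewrite all_map; apply: eq_in_all => e /Alt lt /=.
  by rewrite difference_row_edge // subr_eq0.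
rewrite (eq_bigl (fun p => (p.2 != 0) && P p.2 p.1)) => [|[y t]]; last exact: okE.
rewrite -(pair_big_dep (fun _ => true) (fun y t => (t != 0) && P t y) (fun _ _ => 1%N)) /=.
rewrite (exchange_big_dep (fun t => t != 0)) => [|y t _ /andP[]//].
apply: eq_bigr => t t0; rewrite sum1_card; apply: eq_card => y.
by rewrite !inE unfold_in /= t0.
Qed.

End EdgeColumns.

(** * Periods *)

Lemma lcm_upto_gt0 B : (0 < lcm_upto B)%N.
Proof.
rewrite /lcm_upto big_nat_cond; apply: (big_ind (fun d => 0 < d)%N) => // [x y|k /andP[/andP[]//]].
by rewrite lcmn_gt0 => ->.
Qed.

Lemma lcm_upto_dvdP B d :
  reflect (forall r, (0 < r <= B)%N -> (r %| d)%N) (lcm_upto B %| d)%N.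
Proof.
rewrite /lcm_upto; elim: B => [|B IH].
  by rewrite big_geq // dvd1n; constructor => r; case: r.
rewrite big_nat_recr //= dvdn_lcm; apply: (iffP andP) => [[/IH dB Bd] r|dB].
  by case/andP=> r0; rewrite leq_eqVlt => /orP[/eqP->//|rB]; apply: dB; rewrite r0.
split; last by apply: dB; rewrite leqnn.
by apply/IH => r /andP[r0 rB]; apply: dB; rewrite r0 leqW.
Qed.

Section DivisorSums.
Variables (f0 : {poly int}) (h : nat -> {poly int}) (B : nat).

(** The sum starts at 2 because order 1 belongs to [t = 0], which is excluded. *)
Definition divisor_sum (k : int) : {poly int} :=
  f0 + \sum_(2 <= r < B.+1 | (r%:Z %| k)%Z) h r.

Lemma divisor_sum_mod (k k' : int) :
  (k = k' %[mod lcm_upto B])%Z -> divisor_sum k = divisor_sum k'.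
Proof.
move=> kk'; rewrite /divisor_sum; congr (_ + _).
rewrite [LHS]big_nat_cond [RHS]big_nat_cond; apply: eq_bigl => r; case: (boolP (2 <= r < B.+1)%N) => //= /andP[r2 rB].
have rL : (r%:Z %| (lcm_upto B)%:Z)%Z.
  by move/lcm_upto_dvdP: (dvdnn (lcm_upto B)); apply; rewrite (ltnW r2).
have rkk' : (r%:Z %| k - k')%Z.
  by apply: dvdz_trans rL _; rewrite -eqz_mod_dvd; apply/eqP.
apply/idP/idP => rk; first by rewrite -[k'](subKr k) rpredB.
by rewrite -(subrK k' k) rpredD.
Qed.

Variable R : realType.

Lemma min_period_divisor_sum N p (C : 'M[int]_(N, p)) (q0 : nat) (sgn : int) :
  (forall q : nat, (q0 <= q)%N ->
     (char_count C q)%:Z = (divisor_sum q%:Z).[q%:Z]) ->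
  (forall r, (1 < r <= B)%N -> 0 < sgn * (h r).[-1]) ->
  min_period R C = lcm_upto B.
Proof.
move=> CE hpos.
pose F k : {poly R[i]} := map_poly intr (divisor_sum k).
pose chi (q : int) := (F q).[q%:~R].
have FE k (x : int) : (F k).[x%:~R] = ((divisor_sum k).[x])%:~R by rewrite horner_map.
have per : quasi_period chi (lcm_upto B).
  split; first exact: lcm_upto_gt0.
  by exists (fun k => F k%:Z) => q k qk; rewrite /chi /F (divisor_sum_mod qk).
apply: (@min_periodE _ _ _ _ chi); first split; first by exists (lcm_upto B).
  by exists q0 => q /CE qE; rewrite /chi FE -qE.
split=> // rho' [rho'0 [f' f'E]].
suff dv : (lcm_upto B %| rho')%N by apply: dvdn_leq.
pose L := lcm_upto B; have L0 : (0 < L)%N := lcm_upto_gt0 B.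
(* On the progression of step [L * rho'] through [a], both polynomials compute [chi]; hence the
   constituent of residue 0 is [F a] for every multiple [a] of [rho']. *)
have FF (a : int) : (a = 0 %[mod rho'])%Z -> f' (Ordinal rho'0) = F a.
  move=> a0; apply: (@poly_eq_large _ _ _ a (L * rho')); first by rewrite muln_gt0 L0.
  exists 0%N => t _; rewrite -f'E /=; last first.
    by rewrite mulnA PoszM addrC modzMDl.
  rewrite /chi /F; congr (map_poly _ _).[_]; apply: divisor_sum_mod.
  by rewrite mulnCA mulnC PoszM addrC modzMDl.
have : F 0 = F rho' by rewrite -!FF // modzz mod0z.
move/(congr1 (fun P => P.[(-1)%:~R])); rewrite !FE => /intr_inj.
rewrite /divisor_sum !hornerD => /addrI /(congr1 (fun x => sgn * x)).
rewrite !horner_sum !mulr_sumr => /eqP.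
(* [F 0] contains every [h r], [F rho'] only those with [r] dividing [rho']. The difference is a
   vanishing sum of nonnegative terms, so no [r] is missing. *)
rewrite -subr_eq0 big_mkcond [X in _ - X]big_mkcond -sumrB /= big_nat_cond.
rewrite psumr_eq0 => [/allP all0|r /andP[/andP[r2 rB] _]]; last first.
  have := hpos r; rewrite r2 -ltnS rB dvdz0 => /(_ isT) /ltW.
  by case: ifP; rewrite ?subrr ?subr0.
apply/lcm_upto_dvdP => r /andP[r0 rB].
case: (ltngtP r 1) r0 => // [r2 _|->]; last by rewrite dvd1n.
have := all0 r; rewrite mem_index_iota r2 ltnS rB => /(_ isT) /=.
rewrite dvdz0; case: (boolP (r%:Z %| rho'%:Z)%Z) => // _.
by rewrite subr0 gt_eqF // hpos // r2.
Qed.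

End DivisorSums.

(** * Orders of elements and independence of the edge list *)

Lemma mulrz_eq0_order (G : finZmodType) (t : G) (c : int) :
  (t *~ c == 0) = (#[t]%g %| c)%Z.
Proof.
have nat_case (k : nat) : (t *+ k == 0) = (#[t]%g %| k)%N.
  by rewrite order_dvdn FinRing.zmodXgE FinRing.zmod1gE.
by case: c => k; rewrite ?NegzE ?mulrNz ?oppr_eq0 nat_case.
Qed.

(** A cyclic group has exactly one subgroup of order [r], and it has [totient r] generators. *)
Lemma card_order_Zp q r : (r %| q.+1)%N ->
  #|[set t : 'I_q.+1 | #[t]%g == r]| = totient r.
Proof.
move=> rq; pose a : 'I_q.+1 := (Zp1 ^+ (#[Zp1 : 'I_q.+1] %/ r))%g.
have q1 : #[Zp1 : 'I_q.+1]%g = q.+1 := order_Zp1 q.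
have ar : #[a]%g = r by rewrite orderXdiv ?q1 ?dvdn_div // divnA // mulKn.
rewrite -{2}ar totient_gen; apply: eq_card => t; rewrite !inE.
have := @cycle_sub_group _ (Zp1 : 'I_q.+1) r; rewrite q1 => /(_ rq) /setP /(_ <[t]>%G).
rewrite !inE -Zp_cycle subsetT /= => ->.
by rewrite /generator -val_eqE /= eq_sym /a q1.
Qed.

Lemma int_poly_eq_multiples (f g : {poly int}) (d : nat) : (0 < d)%N ->
  (forall k : nat, f.[(d * k.+2)%:Z] = g.[(d * k.+2)%:Z]) -> f = g.
Proof.
move=> d0 fg; apply/eqP; rewrite -subr_eq0; apply/eqP; set h := f - g.
apply: (@roots_geq_poly_eq0 _ _ [seq (d * k.+2)%:Z | k <- iota 0 (size h)]).
- by apply/allP => _ /mapP[k _ ->]; rewrite /root hornerD hornerN fg subrr.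
- rewrite map_inj_uniq ?iota_uniq // => i j []; move/eqP.
  by rewrite eqn_pmul2l // => /eqP [].
- by rewrite size_map size_iota.
Qed.

(** The recursion reads an ordered list, but colorings only see its members. Every multiple of [r]
    gives a cyclic group with an element of order [r], so the polynomials agree at infinitely many
    points. *)
Lemma gain_poly_eq_mem (I : finType) (i0 : I) (r : nat) (A A' : seq (edge I)) :
  (0 < r)%N -> A =i A' -> gain_poly r A = gain_poly r A'.
Proof.
move=> r0 AA'; apply: (int_poly_eq_multiples r0) => k.
have [q qE] : exists q, (r * k.+2)%N = q.+1 by exists (r * k.+2).-1; rewrite prednK // muln_gt0 r0.
have : (0 < #|[set t : 'I_q.+1 | #[t]%g == r]|)%N.
  by rewrite card_order_Zp ?totient_gt0 // -qE dvdn_mulr.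
case/card_gt0P => t; rewrite inE => /eqP tr.
have ht (c : int) : (t *~ c == 0) = (r %| c)%Z by rewrite mulrz_eq0_order tr.
have cA := proper_coloring_card i0 A ht; have cA' := proper_coloring_card i0 A' ht.
rewrite card_ord in cA cA'; rewrite qE; apply: (mulfI (isT : q.+1%:Z != 0)).
rewrite -cA -cA'; congr Posz; apply: eq_card => y.
by rewrite !inE; apply: eq_all_r.
Qed.

(** * Minimum period of an integral gain graph *)

Section GainGraphPeriod.
Variables (R : realType) (n : nat) (cols : seq 'cV[int]_(n + 1)).
Variables (A : seq (edge 'I_n.+1)) (B : nat).
Hypothesis colsE : cols =i infinity_col n :: map (@edge_col n) A.
Hypothesis A_lt : forall e, e \in A -> (e.1.1 < e.1.2)%N.
Hypothesis large_integral : forall A', A' =i A -> forall r, (B < r)%N ->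
  gain_poly r A' = gain_poly 0 A'.

Lemma char_count_divisor_sum q :
  (char_count (mx_of_cols cols) q.+2)%:Z =
  (divisor_sum (('X - 1) * gain_poly 0 A)
     (fun r => (gain_poly r A - gain_poly 0 A) *+ totient r) B q.+2%:Z).[q.+2%:Z].
Proof.
have q0 : q.+2%:Z != 0 by [].
have cE : (char_count (mx_of_cols cols) q.+2)%:Z =
    \sum_(t : 'I_q.+2 | t != 0) (gain_poly #[t]%g A).[q.+2%:Z].
  apply: (mulfI q0); rewrite -PoszM (char_count_edges _ colsE A_lt).
  rewrite -natz natr_sum mulr_sumr; apply: eq_bigr => t _; rewrite natz.
  rewrite (proper_coloring_card ord0 (r := #[t]%g)) ?card_ord // => c.
  exact: mulrz_eq0_order.
rewrite {}cE; pose D r := (gain_poly r A - gain_poly 0 A).[q.+2%:Z].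
rewrite (eq_bigr (fun t : 'I_q.+2 => (gain_poly 0 A).[q.+2%:Z] + D #[t]%g)); last first.
  by move=> t _; rewrite /D hornerD hornerN addrC subrK.
rewrite big_split /= /divisor_sum hornerD; congr (_ + _).
  rewrite sumr_const hornerM !hornerE -mulr_natl; congr (_ * _).
  rewrite (_ : #|_| = q.+1) ?natz; first by rewrite -[q.+2]addn1 PoszD addrK.
  by have := cardC1 (0 : 'I_q.+2); rewrite card_ord.
rewrite horner_sum.
transitivity (\sum_(2 <= r < B.+1) \sum_(t : 'I_q.+2 | #[t]%g == r) D r).
  rewrite (exchange_big_dep predT) //= big_mkcond; apply: eq_bigr => t _.
  have t2 : (t != 0) = (1 < #[t]%g)%N.
    by rewrite ltn_neqAle order_gt0 andbT [in RHS]eq_sym order_eq1.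
  (* Orders above [B] contribute nothing, by [large_integral]. *)
  case: (ltnP #[t]%g B.+1) => tB; last first.
    rewrite big_nat_cond big1 ?if_same => [|r /andP[/andP[_ rB] /eqP tr]]; last first.
      by move: tB; rewrite tr leqNgt rB.
    by case: ifP => // _; rewrite /D large_integral // subrr horner0.
  rewrite t2; case: ifP => t1.
    rewrite big_mkcond (bigD1_seq #[t]%g) ?iota_uniq ?mem_index_iota ?t1 ?tB //=.
    by rewrite eqxx big1 ?addr0 // => r /negPf; rewrite eq_sym => ->.
  rewrite big_nat_cond big1 // => r /andP[/andP[r2 _] /eqP tr].
  by rewrite tr r2 in t1.
rewrite [RHS]big_mkcond; apply: eq_bigr => r _.
rewrite sumr_const; case: ifP => rq.
  by rewrite hornerMn -(card_order_Zp rq); congr (_ *+ _); apply: eq_card => t; rewrite !inE.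
rewrite eq_card0 // => t; apply: contraFF rq => /eqP <-.
by have := @order_dvdG _ [set: 'I_q.+2]%G t (in_setT t); rewrite cardsT card_ord.
Qed.

(** The list [A'] may depend on [r] and repeat edges, so that a cycle of gain [r] can be placed at
    its end. *)
Lemma gain_graph_min_period :
  (forall r, (0 < r <= B)%N ->
     exists2 A', A' =i A & (whitney r A' < whitney 0 A')%N) ->
  min_period R (mx_of_cols cols) = lcm_upto B.
Proof.
move=> strict.
(* At -1, the difference of [gain_poly r] and [gain_poly 0] is [(-1) ^+ n] times a negative integer,
   whence the sign. *)
apply: (@min_period_divisor_sum _ _ _ _ _ _ _ 2 (- (-1) ^+ n)).
  by case=> [|[|q]] // _; apply: char_count_divisor_sum.
move=> r /andP[r1 rB]; have r0 := ltnW r1.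
have [A' A'A lt] := strict r (introT andP (conj r0 rB)).
(* Independence of the list is known for positive orders; order [B.+1] transfers it to 0. *)
have r0E : gain_poly 0 A = gain_poly 0 A'.
  rewrite -(large_integral (fun _ => erefl) (ltnSn B)) -(large_integral A'A (ltnSn B)).
  by apply: (gain_poly_eq_mem ord0) => // e; rewrite A'A.
rewrite r0E -(gain_poly_eq_mem ord0 r0 A'A) hornerMn hornerD hornerN.
rewrite !horner_gain_polyN1 card_ord /= -mulrBr -mulrnAr mulrA mulNr -expr2 sqrr_sign mulN1r.
rewrite -mulNrn opprB pmulrn_lgt0 ?totient_gt0 //.
by rewrite subr_gt0 ltz_nat.
Qed.

End GainGraphPeriod.

(** * Deformations and cIsh *)

Lemma mem_zrange (l m c : int) : (c \in zrange l m) = (l <= c <= m).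
Proof.
rewrite /zrange; case: ifPn => lm; last first.
  by rewrite in_nil; apply/esym/negP => /andP[lc cm]; rewrite (le_trans lc cm) in lm.
apply/mapP/idP => [[k] | cr]; first by rewrite mem_iota => kr ->; lia.
by exists `|c - l|%N; rewrite ?mem_iota; lia.
Qed.

Lemma pos_rootsP n (b : 'cV[int]_n) :
  reflect (exists i j : 'I_n.+1, (i < j)%N /\ b = pos_root n i.+1 j.+1) (b \in pos_roots n).
Proof.
apply: (iffP allpairsPdep) => [[i [j []]]|[i [j [ij ->]]]].
  rewrite !mem_index_iota; case: i => // i; case: j => // j /andP[_ iN] /andP[ij jN] ->.
  by exists (Ordinal (iN : (i < n.+1)%N)), (Ordinal (jN : (j < n.+1)%N)).
have := ltn_ord i; have := ltn_ord j => jn iN.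
by exists i.+1, j.+1; split=> //; rewrite mem_index_iota; lia.
Qed.

Definition ordered_edges n (gains : nat -> nat -> seq int) : seq (edge 'I_n.+1) :=
  [seq (p.1, p.2, c) | p : 'I_n.+1 * 'I_n.+1 <- [seq p : 'I_n.+1 * 'I_n.+1 <- enum predT | (p.1 < p.2)%N],
                       c : int <- gains p.1 p.2].

Lemma mem_ordered_edges n gains (e : edge 'I_n.+1) :
  (e \in ordered_edges n gains) = (e.1.1 < e.1.2)%N && (e.2 \in gains e.1.1 e.1.2).
Proof.
apply/allpairsPdep/andP => [[p [c [+ cg ->]]]|[lt eg]].
  by rewrite mem_filter => /andP[lt _].
case: e lt eg => [[i j] c] /= lt eg; exists (i, j), c; split=> //.
by rewrite mem_filter lt mem_enum.
Qed.

Lemma deformation_cols_edges n l m :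
  deformation_cols n l m
    =i infinity_col n :: map (@edge_col n) (ordered_edges n (fun _ _ => zrange l m)).
Proof.
move=> v; rewrite mem_rcons !inE; congr (_ || _).
apply/allpairsPdep/mapP => [[b [c [/pos_rootsP[i [j [ij ->]]] cr ->]]]|[e]].
  by exists (i, j, c); rewrite // mem_ordered_edges ij.
rewrite mem_ordered_edges => /andP[lt er] ->.
exists (pos_root n e.1.1.+1 e.1.2.+1), e.2; split=> //.
by apply/pos_rootsP; exists e.1.1, e.1.2.
Qed.

(** Vertices count from 0, so gains 1 to [j] are the extra columns of the root with indices 1 and
    [j.+1]; gain 0 is the root itself. *)
Definition cIsh_gains (i j : nat) : seq int :=
  if i == 0%N then zrange 0 j%:Z else [:: 0].

Lemma cIsh_cols_edges n :
  cIsh_cols n =i infinity_col n :: map (@edge_col n) (ordered_edges n cIsh_gains).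
Proof.
move=> v; rewrite !mem_cat !inE orbA orbC; congr (_ || _).
apply/orP/mapP => [[/mapP[b /pos_rootsP[i [j [ij ->]]] ->]|]|[e]].
- exists (i, j, 0); rewrite // mem_ordered_edges ij /cIsh_gains /=.
  by case: ifP => _; rewrite ?mem_zrange ?inE.
- case/allpairsPdep=> j [x []]; rewrite !mem_index_iota; case: j => // j jr xr ->.
  have jn : (j < n.+1)%N by lia.
  exists (ord0, Ordinal jn, x%:Z) => //.
  by rewrite mem_ordered_edges /cIsh_gains /= mem_zrange; lia.
rewrite mem_ordered_edges /cIsh_gains; case: e => [[i j] c] /= /andP[ij].
have root : pos_root n i.+1 j.+1 \in pos_roots n by apply/pos_rootsP; exists i, j.
have [->|c0] := eqVneq c 0; first by move=> _ ->; left; apply: map_f.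
case: ifP => [/eqP i0|_]; last by rewrite inE (negbTE c0).
rewrite mem_zrange => cr ->; right; apply/allpairsPdep; exists j.+1, `|c|%N.
rewrite !mem_index_iota; have := ltn_ord j => jn; split; [lia | lia |].
by rewrite /edge_col /= i0 gez0_abs //; case/andP: cr.
Qed.

(** * Loop gains in the deformation *)

Section DeformationLoops.
Variables (n : nat) (l m : int).
Hypothesis hlm : - m <= l <= m.
Implicit Types (s : switching 'I_n.+1) (u v : 'I_n.+1) (p : seq 'I_n.+1).

(** Two vertices of one class are adjacent when the switching satisfies the equation of some edge
    between them. *)
Definition switched_adj s : rel 'I_n.+1 := fun u v =>
  ((s u).1 == (s v).1) &&
  (((u < v)%N && (l <= (s u).2 - (s v).2 <= m)) ||
   ((v < u)%N && (l <= (s v).2 - (s u).2 <= m))).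

(* The bounds on loop gains come from simple paths inside a class, which have at
   most [n] edges. *)
Definition connected_classes s : Prop :=
  forall u v, (s u).1 = (s v).1 -> connect (switched_adj s) u v.

Lemma switched_adj_sym s : connect_sym (switched_adj s).
Proof.
apply: sym_connect_sym => u v.
by rewrite /switched_adj eq_sym orbC.
Qed.

(** A step to a smaller vertex raises the potential by at most [m], a step to a larger one by at
    most [- l <= m]. A path ending above its start has a step of the second kind. *)
Lemma path_switched_adj_le s u p : path (switched_adj s) u p ->
  (s (last u p)).2 - (s u).2 <= m * (size p)%:Z /\
  ((u < last u p)%N -> (s (last u p)).2 - (s u).2 <= m * (size p)%:Z - m - l).
Proof.
elim: p u => [|w p IH] u /=; first by rewrite subrr mulr0 ltnn.
case/andP=> /andP[_ uw] /IH[le lt].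
have -> : m * (size p).+1%:Z = m * (size p)%:Z + m by rewrite -addn1 PoszD mulrDr mulr1.
move: (m * _ : int) (s _).2 (s w).2 (s u).2 uw le lt => M x y z uw le lt; split; first by lia.
case: (ltnP w (last w p)) => [wl|wl]; first by have := lt wl; lia.
lia.
Qed.

Lemma connected_class_le s u v : connected_classes s -> (s u).1 = (s v).1 ->
  (s v).2 - (s u).2 <= m * n%:Z /\
  ((u < v)%N -> (s v).2 - (s u).2 <= m * n%:Z - m - l).
Proof.
move=> conn /conn /connectP[p pth ->].
case/shortenP: pth => p' pth' uniq_p' _.
have sz : (size p' <= n)%N.
  by have := max_card [in u :: p']; rewrite (card_uniqP uniq_p') card_ord.
have [le lt] := path_switched_adj_le pth'.
have mono : m * (size p')%:Z <= m * n%:Z by rewrite ler_wpM2l ?lez_nat //; lia.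
split=> [|/lt h]; first exact: le_trans le mono.
by apply: le_trans h _; rewrite !lerD2r.
Qed.

(** The upper bound adds [m] to the bound for a path going up; the lower bound combines [l] with the
    general bound for the reverse path. *)
Lemma connected_classes_loop s e : connected_classes s ->
  e \in ordered_edges n (fun _ _ => zrange l m) -> is_loop s e ->
  `|gain s e| <= m * n%:Z - l.
Proof.
move=> conn; rewrite mem_ordered_edges mem_zrange => /andP[lt er] /eqP loop_e.
have [_ /(_ lt) le1] := connected_class_le conn loop_e.
have [le2 _] := connected_class_le conn (esym loop_e).
rewrite ler_norml /gain; move: (s e.1.1).2 (s e.1.2).2 (m * n%:Z : int) le1 le2 => x y M.
by lia.
Qed.

(** Contraction shifts a whole class by a constant, which keeps its adjacencies, and [e] becomes an
    adjacency between the two merged classes. *)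
Lemma connected_classes_contract s e : connected_classes s ->
  e \in ordered_edges n (fun _ _ => zrange l m) -> ~~ is_loop s e ->
  connected_classes (contract s e).
Proof.
move=> conn; rewrite mem_ordered_edges mem_zrange => /andP[lt er] nle.
have shiftK x y : x + gain s e - (y + gain s e) = x - y.
  by rewrite opprD addrACA subrr addr0.
have adj u v : switched_adj s u v -> switched_adj (contract s e) u v.
  rewrite /switched_adj /contract => /andP[/eqP uv]; rewrite uv.
  case: ifP => _ /=; last by rewrite uv eqxx.
  by rewrite eqxx /= !shiftK.
have sub u v : (s u).1 = (s v).1 -> connect (switched_adj (contract s e)) u v.
  by move/conn; apply: (connect_sub (e := switched_adj s)) => x y /adj; apply: connect1.
have edge_adj : connect (switched_adj (contract s e)) e.1.1 e.1.2.
  apply: connect1; rewrite /switched_adj /contract eqxx /=.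
  have /negbTE ne : (s e.1.2).1 != (s e.1.1).1 by rewrite eq_sym.
  by rewrite ne /= eqxx lt /gain /= addrA addrK subrKC er.
have to_e u : (s u).1 = (s e.1.1).1 -> connect (switched_adj (contract s e)) u e.1.2.
  by move=> /sub ue; apply: connect_trans ue edge_adj.
move=> u v; rewrite /contract; case: eqP => ue; case: eqP => ve //= uv.
- by apply: sub; rewrite ue ve.
- by apply: connect_trans (to_e _ ue) _; apply: sub.
- by rewrite switched_adj_sym; apply: connect_trans (to_e _ ve) _; apply: sub.
- exact: sub.
Qed.

End DeformationLoops.

(** * Cycles of prescribed gain *)

Section HamiltonianCycle.
Variables (n : nat) (c : nat -> int) (d : int).

Definition path_edge k : edge 'I_n.+1 := (inord k, inord k.+1, c k).

Definition cycle_edges : seq (edge 'I_n.+1) :=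
  [seq path_edge k | k <- iota 0 n] ++ [:: (ord0, ord_max, d)].

(** The state after contracting the first [k] path edges: vertices 0 to [k] are merged into [k]. *)
Definition path_switching k : switching 'I_n.+1 := fun u =>
  if (u <= k)%N then (inord k, \sum_(u <= h < k) c h) else (u, 0).

Lemma path_switching0 : path_switching 0 = @no_switching 'I_n.+1.
Proof.
apply/funext => u; rewrite /path_switching /no_switching leqn0.
by case: eqP => // u0; rewrite u0 big_geq // -u0 inord_val.
Qed.

Lemma path_edge_nonloop k : (k < n)%N -> ~~ is_loop (path_switching k) (path_edge k).
Proof.
move=> kn; have [k1 k2] : (k < n.+1)%N /\ (k.+1 < n.+1)%N by lia.
rewrite /is_loop /path_switching /= !inordK // leqnn ltnn /=.
by rewrite -val_eqE /= !inordK // ltn_eqF.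
Qed.

Lemma path_switching_contract k : (k < n)%N ->
  contract (path_switching k) (path_edge k) = path_switching k.+1.
Proof.
move=> kn; have [k1 k2] : (k < n.+1)%N /\ (k.+1 < n.+1)%N by lia.
apply/funext => u; rewrite /contract /gain /path_switching /=.
rewrite !inordK // leqnn ltnn /= (big_geq (leqnn k)) subr0 addr0.
case: (leqP u k) => uk /=.
  by rewrite eqxx leqW // big_nat_recr.
rewrite -val_eqE /= inordK // gtn_eqF //.
case: (leqP u k.+1) => // uk1; have uE : u = k.+1 :> nat by lia.
by rewrite uE big_geq // -uE inord_val.
Qed.

(** Contracting the whole path turns the closing edge into a loop of gain [- r], which gives zero
    modulo [r] but not over the integers. *)
Lemma whitney_cycle_edges_lt r : \sum_(0 <= h < n) c h - d = r%:Z -> (0 < r)%N ->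
  (whitney r cycle_edges < whitney 0 cycle_edges)%N.
Proof.
move=> sum_r r0; rewrite /whitney -path_switching0 /cycle_edges.
pose lt k j := (whitney_rec r (path_switching k)
  ([seq path_edge h | h <- iota k j] ++ [:: (ord0, ord_max, d)]) <
  whitney_rec 0 (path_switching k)
  ([seq path_edge h | h <- iota k j] ++ [:: (ord0, ord_max, d)]))%N.
suff gen j : forall k, (k + j)%N = n -> lt k j by exact: gen.
elim: j => [|j IH] k kj.
  have kn : k = n by rewrite -kj addn0.
  have gainE : gain (path_switching k) (ord0, ord_max, d) = - r%:Z.
    by rewrite /gain /path_switching kn /= leqnn (big_geq (leqnn n)) addr0 -sum_r opprB.
  apply: whitney_rec_lt_loop; rewrite ?gainE ?oppr_eq0 ?eqz_nat -?lt0n //.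
    by rewrite /is_loop /path_switching kn /= leqnn.
  by rewrite rpredN dvdzz.
have kn : (k < n)%N by lia.
apply: whitney_rec_lt_contract; first exact: path_edge_nonloop.
by rewrite path_switching_contract //; apply: IH; lia.
Qed.

End HamiltonianCycle.

Lemma sum_in_range (l m : int) k (T : int) : l <= m ->
  k%:Z * l <= T <= k%:Z * m ->
  exists2 c : nat -> int, forall h, l <= c h <= m & \sum_(0 <= h < k) c h = T.
Proof.
move=> lm; elim: k T => [|k IH] T.
  rewrite !mul0r => T0; exists (fun _ => l) => [_|]; first by rewrite lexx.
  by rewrite big_geq //; lia.
rewrite -addn1 PoszD !mulrDl !mul1r => TR.
have [x xR TxR] : exists2 x, l <= x <= m & k%:Z * l <= T - x <= k%:Z * m.
  have : k%:Z * l <= k%:Z * m by rewrite ler_wpM2l.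
  move: (k%:Z * l : int) (k%:Z * m : int) TR => a b TR ab.
  (* Take the least summand, unless the rest would then exceed its maximum [b]; in that case the
     rest is exactly [b]. *)
  case: (leP (T - l) b) => Tb; [exists l | exists (T - b)]; lia.
have [c cR cT] := IH _ TxR.
exists (fun h => if h == k then x else c h) => [h|]; first by case: ifP.
rewrite addn1 big_nat_recr //= eqxx (eq_big_nat _ _ (F2 := c)) ?cT ?subrK // => h.
by case/andP=> _ hk; rewrite ltn_eqF.
Qed.

Lemma deformation_min_period (R : realType) n (l m : int) : (0 < n)%N ->
  `|l| <= m -> n%:Z * l <= m + 1 ->
  min_period R (deformation n l m) = lcm_upto `|(m * n%:Z - l)%R|%N.
Proof.
move=> n0; rewrite ler_norml => hlm hnl.
set E := ordered_edges n (fun _ _ => zrange l m).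
have B0 : 0 <= m * n%:Z - l.
  have : m * 1 <= m * n%:Z by rewrite ler_wpM2l //; lia.
  by move: (m * n%:Z : int) => M; rewrite mulr1; lia.
apply: (gain_graph_min_period R (A := E)).
- exact: deformation_cols_edges.
- by move=> e; rewrite mem_ordered_edges => /andP[].
- move=> A' A'E r Br; apply: (@gain_poly_rec_integral _ _ (@connected_classes n l m)).
  + by move=> s e cs; rewrite A'E; apply: connected_classes_contract.
  + move=> s e cs; rewrite A'E => eE /(connected_classes_loop hlm cs eE) le.
    by apply: le_lt_trans le _; rewrite -[X in X < _]gez0_abs // ltz_nat.
  + by move=> u v /= ->.
- move=> r /andP[r0]; rewrite -lez_nat gez0_abs // => rB.
  have lm : l <= m by lia.
  (* The path must have total gain [r + d]. If [d = m] is not too large, [n l <= m + 1 <= r + m]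
     gives the lower bound; otherwise the path takes its maximum [n m], and [r <= m n - l] gives
     [l <= d]. *)
  have [d dR rdR] : exists2 d, l <= d <= m & n%:Z * l <= r%:Z + d <= n%:Z * m.
    have lnm : n%:Z * l <= n%:Z * m by rewrite ler_wpM2l.
    rewrite mulrC in rB; move: (n%:Z * l : int) (n%:Z * m : int) hnl rB lnm => a b h1 h2 h3.
    case: (leP (r%:Z + m) b) => rm; [exists m | exists (b - r%:Z)]; lia.
  have [c cR cT] := sum_in_range lm rdR.
  exists (E ++ cycle_edges n c d).
    move=> e; rewrite mem_cat; case: (boolP (e \in E)) => //= nE.
    apply: contraNF nE; rewrite mem_cat => /orP[/mapP[k]|].
      rewrite mem_iota => kn ->; rewrite mem_ordered_edges mem_zrange /= cR andbT.
      by rewrite !inordK ?ltnS //; lia.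
    by rewrite inE => /eqP ->; rewrite mem_ordered_edges mem_zrange /= n0.
  apply: whitney_lt_cat.
    move=> e; rewrite mem_ordered_edges => /andP[lt _].
    by rewrite -val_eqE ltn_eqF.
  by apply: whitney_cycle_edges_lt => //; rewrite cT addrK.
Qed.

(** * Loop gains in cIsh *)

Section CIshLoops.
Variable n : nat.
Implicit Types (s : switching 'I_n.+1) (u v : 'I_n.+1).

(* Only edges at the first vertex have nonzero gain, so a class that does not
   contain it has constant potential. *)
Definition central_potential s : Prop := forall u,
  ((s u).1 = (s ord0).1 -> 0 <= (s ord0).2 - (s u).2 <= n%:Z) /\
  ((s u).1 <> (s ord0).1 -> forall v, (s v).1 = (s u).1 -> (s v).2 = (s u).2).

(** In the class of the first vertex, potentials lie in an interval of length [n] with that vertex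
    at the top. An edge at this vertex adds a gain in the range 0 to [n], and all other edges have
    gain 0. *)
Lemma central_potential_loop s e : central_potential s ->
  e \in ordered_edges n cIsh_gains -> is_loop s e -> `|gain s e| <= n%:Z.
Proof.
case: e => [[i j] c]; rewrite mem_ordered_edges /cIsh_gains /is_loop /gain /=.
move=> cs /andP[ij ce] /eqP loop_e; have jn : (j <= n)%N by rewrite -ltnS.
have [i_in i_out] := cs i; have [j_in j_out] := cs j; rewrite ler_norml.
move: ce; case: ifP => [/eqP i0|_].
  have {}i0 : i = ord0 by apply: val_inj.
  rewrite mem_zrange; have := j_in; rewrite -loop_e i0 => /(_ erefl).
  by move: (s j).2 (s ord0).2 => x y; lia.
rewrite inE => /eqP ->; have [i0|i0] := eqVneq (s i).1 (s ord0).1.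
  have := i_in i0; have := j_in; rewrite -loop_e => /(_ i0).
  by move: (s i).2 (s j).2 (s ord0).2 => x y z; lia.
rewrite (i_out (elimN eqP i0) j (esym loop_e)).
by rewrite sub0r addNr oppr_le0.
Qed.

(** At least one of the merged classes avoids the first vertex and so has constant potential; hence
    one comparison with the first vertex settles all its members. *)
Lemma central_potential_contract s e : central_potential s ->
  e \in ordered_edges n cIsh_gains -> ~~ is_loop s e ->
  central_potential (contract s e).
Proof.
case: e => [[i j] c]; rewrite mem_ordered_edges /cIsh_gains /is_loop /=.
move=> cs /andP[ij ce] ne; have jn : (j <= n)%N by rewrite -ltnS.
have c_in u := (cs u).1; have c_out u v uo := (cs u).2 uo v.
set g := gain s (i, j, c); have gE : g = c - (s i).2 + (s j).2 by [].
have ne' : (s j).1 != (s i).1 by rewrite eq_sym.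
have c0 : (s ord0).1 != (s i).1 -> c = 0.
  move=> i0; move: ce; case: ifP => [/eqP i0'|_]; last by rewrite inE => /eqP.
  by move: i0; rewrite (_ : i = ord0) ?eqxx //; apply: val_inj.
have move_i w : (s ord0).1 != (s i).1 -> (s w).1 = (s i).1 -> (s w).2 + g = (s j).2.
  move=> i0 wi; rewrite gE (c0 i0) sub0r addrA (c_out i w _ wi) ?subrr ?add0r //.
  by apply/eqP; rewrite eq_sym.
move=> u; rewrite /contract /= -/g; have [z0|z0] := eqVneq (s ord0).1 (s i).1 => /=.
  split.
    case: eqVneq => [ui _ /=|ui /= uj].
      have := c_in u; rewrite z0 ui => /(_ erefl).
      by rewrite opprD addrACA subrr addr0.
    rewrite (c_out j u) ?uj //; last by rewrite z0; apply/eqP.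
    (* The new difference is [c] if [i] is the first vertex; otherwise [c = 0] and it is the old
       difference at [i]. *)
    rewrite gE [_ + (s j).2]addrC addrCA [(s j).2 + _]addrC addrK.
    move: ce; case: ifP => [/eqP i0|_].
      rewrite (_ : i = ord0) ?subrKC; last exact: val_inj.
      by rewrite mem_zrange; lia.
    by rewrite inE => /eqP ->; rewrite sub0r; apply: c_in.
  case: eqVneq => [//|ui /= uj v]; case: eqVneq => [_ /= /esym//|vi /= vu].
  by apply: c_out; rewrite // z0; apply/eqP.
split.
  case: eqVneq => [ui /= jz|ui /= uz]; last exact: c_in.
  by rewrite move_i //; apply: c_in.
case: eqVneq => [ui /= jz v|ui /= uz v]; case: eqVneq => [vi /= vu|vi /= vu].
- by rewrite !move_i.
- by rewrite (move_i u) //; apply: c_out.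
- by rewrite move_i //; apply: c_out.
- exact: c_out.
Qed.

End CIshLoops.

Lemma cIsh_min_period (R : realType) n : (0 < n)%N ->
  min_period R (cIsh n) = lcm_upto n.
Proof.
move=> n0; set E := ordered_edges n cIsh_gains.
apply: (gain_graph_min_period R (A := E)).
- exact: cIsh_cols_edges.
- by move=> e; rewrite mem_ordered_edges => /andP[].
- move=> A' A'E r Br; apply: (@gain_poly_rec_integral _ _ (@central_potential n)).
  + by move=> s e cs; rewrite A'E; apply: central_potential_contract.
  + move=> s e cs; rewrite A'E => eE /(central_potential_loop cs eE) le.
    by apply: le_lt_trans le _; rewrite ltz_nat.
  + by move=> u; split=> //=; rewrite subrr.
- move=> r /andP[r0 rn].
  (* The edges of gains 0 and [r] from the first vertex to vertex [r] form a cycle of length 2; gain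
     [r] is the largest allowed there. *)
  pose v : 'I_n.+1 := inord r; have vE : v = r :> nat by rewrite inordK.
  exists (E ++ [:: (ord0, v, 0); (ord0, v, r%:Z)]).
    move=> e; rewrite mem_cat; case: (boolP (e \in E)) => //= nE.
    apply: contraNF nE; rewrite !inE => /orP[] /eqP ->.
      by rewrite mem_ordered_edges /cIsh_gains /= mem_zrange vE r0.
    by rewrite mem_ordered_edges /cIsh_gains /= mem_zrange vE r0 /= lexx.
  apply: whitney_lt_cat.
    move=> e; rewrite mem_ordered_edges => /andP[lt _].
    by rewrite -val_eqE ltn_eqF.
  have v0 : ord0 != v by rewrite -val_eqE /= vE eq_sym -lt0n.
  apply: whitney_rec_lt_contract; first by [].
  have gainE : gain (contract (@no_switching 'I_n.+1) (ord0, v, 0)) (ord0, v, r%:Z) = r%:Z.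
    by rewrite /gain /contract /gain /= [v == ord0]eq_sym (negbTE v0) /=; lia.
  apply: whitney_rec_lt_loop; rewrite ?gainE ?dvdzz ?eqz_nat -?lt0n //.
  by rewrite /is_loop /contract /= [v == ord0]eq_sym (negbTE v0) /= eqxx.
Qed.

Theorem theorem1p10 (R : realType) (n : nat) (l m : int)
    (hn : (1 <= n)%N) (hlm : `|l| <= m) (hnl : n%:Z * l <= m + 1) :
  [/\ min_period R (deformation n l m) = lcm_upto `|(m * n%:Z - l)%R|%N,
      min_period R (cIsh n) = lcm_upto n
    & min_period R (deformation n 0 1) = min_period R (cIsh n)].
Proof.
split; [exact: deformation_min_period | exact: cIsh_min_period |].
rewrite cIsh_min_period // deformation_min_period ?normr0 ?mulr0 //.
by rewrite mul1r subr0.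
Qed.
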